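(* A consistency checker $f_C$ can be decomposed to a CNF of polynomial size if and only if it can be computed by a monotone circuit of polynomial size. Explicitly: for a family of consistency checkers $f_C$ (one for each constraint in a family of constraints), there is a polynomial $p$ such that each $f_C$ in the family has a CNF decomposition of size at most $p(|\mathbf{x}|)$ if and only if there is a polynomial $q$ such that each $f_C$ in the family is computed by a monotone Boolean circuit of size at most $q(|\mathbf{x}|)$, where $|\mathbf{x}|$ is the number of literals $X_i=j$ of the initial domains of the constraint.
   Context: **Domains.** A constraint $C$ is on a finite set of variables $\mathbf{X}$, each $X_i$ having a finite initial domain $D(X_i)$; it allows a subset of the possible assignments (its solutions). A literal is an expression $X_i=j$ with $j\in D(X_i)$. $\mathbf{D}(\mathbf{X})$ denotes the set of literals, and $\mathcal{P}(\mathbf{D})$ the set of all such sets, i.e. all subsets of the set of initial literals; an element of $\mathcal{P}(\mathbf{D})$ is a domain setting (some variables may have an empty current domain). **Consistency checker.** A consistency checker for $C$ is a polynomial time computable function $f_C:\mathcal{P}(\mathbf{D})\to\{0,1\}$ that is monotone ($\mathbf{D}'\subseteq\mathbf{D}''$ implies $f_C(\mathbf{D}')\le f_C(\mathbf{D}'')$) and such that if $f_C(\mathbf{D}')=0$ then no assignment using only literals of $\mathbf{D}'$ is a solution of $C$. **Propositional representation.** There is one Boolean variable $x_{i,j}$ for each initial literal $X_i=j$; $\mathbf{x}$ is the set of these. A domain setting $\mathbf{D}'$ is represented by a partial instantiation of $\mathbf{x}$ in which $x_{i,j}$ is false iff $(X_i=j)\notin\mathbf{D}'$; if $(X_i=j)\in\mathbf{D}'$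 then $x_{i,j}$ is unset, except that it may be true when $j$ is the only remaining value of $X_i$. So the same domain setting can have several representations. **Unit propagation.** Starting from a partial instantiation, unit propagation sets a literal to true whenever it appears in a clause all of whose other literals are false, until fixpoint; if all literals of a clause are false, the empty clause is produced. **CNF decomposition of a consistency checker.** A CNF decomposition of $f_C$ is a CNF formula $C_C$ over variables $\mathbf{x}\cup\mathbf{y}\cup\{z\}$ such that: (1) the input variables $\mathbf{x}$ are the propositional representation of the domains, $\mathbf{y}$ is a set of auxiliary variables whose number is polynomial in $|\mathbf{x}|$, and $z$ is the output variable; (2) unit propagation on $C_C$ started from any representation of a domain setting (with no variable of $\mathbf{y}$ set externally) never forces any variable of $\mathbf{x}$ and never generates the empty clause; (3) for every domain setting $\mathbf{D}'$ and every representation of it, $z$ is set to false by unit propagation iff $f_C(\mathbf{D}')=0$. The size of a CNF is its total number of literal occurrences. **Monotone circuits.** A monotone circuit is a Boolean circuit (DAG with input gates as sources and a single output gate) whose non-input gates are $\land$-gates and $\lor$-gates; constants are allowed, so that monotone circuits compute exactly all monotone Boolean functions. It computes $f_C$ if it has one input $b_{i,j}$ for each initial literal and for every domain setting $\mathbf{D}'$ its value on the input with $b_{i,j}=1$ iff $(X_i=j)\in\mathbf{D}'$ equals $f_C(\mathbf{D}')$. *)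

(* Defs.v *)
From HB Require Import structures.
From mathcomp Require Import all_boot all_order all_algebra.

Set Implicit Arguments.
Unset Strict Implicit.
Unset Printing Implicit Defensive.

(* ** Constraints and domain settings *)

Record constraint := Constraint {
  cvar : finType;
  cdom : cvar -> finType;
  csol : {set {dffun forall X : cvar, cdom X}}
}.

(* The literal X = j is [Tagged _ j], with j : cdom X; the number of initial
   literals, written |x| below, is [#|lit C|], and a domain setting is a
   [D : {set lit C}]. *)
Definition lit (C : constraint) : finType := {X : cvar C & cdom X}%type.

Definition uses_only (C : constraint) (a : {dffun forall X : cvar C, cdom X})
    (D : {set lit C}) : Prop :=
  forall X : cvar C, (Tagged (@cdom C) (a X) : lit C) \in D.

(* ** Polynomial time computability: deterministic one-tape Turing machines *)

Inductive symbol (W : Type) := Blank | Sep | Bit of bool | Work of W.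
Arguments Blank {W}.
Arguments Sep {W}.
Arguments Bit {W} b.

Inductive move := MoveLeft | MoveRight | Stay.

(* [tm_verdict q = Some b] means that q is a halting state with answer b. *)
Record machine := Machine {
  tm_state : finType;
  tm_work : finType;
  tm_init : tm_state;
  tm_verdict : tm_state -> option bool;
  tm_delta : tm_state -> symbol tm_work -> tm_state * symbol tm_work * move
}.

(* State, tape to the left of the head (nearest cell first), tape from the head
   cell on to the right; both lists are extended by blanks. *)
Definition config (M : machine) : Type :=
  tm_state M * seq (symbol (tm_work M)) * seq (symbol (tm_work M)).

Definition tm_step (M : machine) (k : config M) : config M :=
  let: (q, l, r) := k in
  if tm_verdict q is Some _ then k else
  let: (q', s, m) := tm_delta q (head Blank r) in
  match m with
  | MoveLeft => (q', behead l, head Blank l :: s :: behead r)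
  | MoveRight => (q', s :: l, behead r)
  | Stay => (q', l, s :: behead r)
  end.

(* Halting configurations are fixed by [tm_step], so this says that M halts with
   answer b after at most t steps. *)
Definition tm_answers (M : machine) (w : seq (symbol (tm_work M))) (t : nat)
    (b : bool) : Prop :=
  let: (q, _, _) := iter t (@tm_step M) (tm_init M, [::], w) in
  tm_verdict q = Some b.

(* The input word: a description of the constraint, followed, for each variable
   X, by a separator and the characteristic vector of the current domain of X. *)
Definition encode (W : Type) (d : seq bool) (C : constraint) (D : {set lit C}) :
    seq (symbol W) :=
  map Bit d ++
  flatten [seq Sep :: [seq Bit ((Tagged (@cdom C) j : lit C) \in D)
                      | j <- enum (cdom X)]
          | X <- enum (cvar C)].

(* A single machine decides all the functions of the family, in time polynomial
   in the length of its input; [descr i] tells it which constraint is considered,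
   and is part of the input (it may be, for instance, the table of C i). *)
Definition polytime (I : Type) (C : I -> constraint) (descr : I -> seq bool)
    (f : forall i, {set lit (C i)} -> bool) : Prop :=
  exists (M : machine) (t : {poly nat}), forall (i : I) (D : {set lit (C i)}),
    let w := encode (tm_work M) (descr i) D in
    tm_answers w t.[size w]%R (f i D).

(* ** Consistency checkers *)

Definition checks (C : constraint) (f : {set lit C} -> bool) : Prop :=
  (forall D1 D2 : {set lit C}, D1 \subset D2 -> f D1 <= f D2) /\
  (forall D : {set lit C}, f D = false ->
     forall a, uses_only a D -> a \notin csol C).

Definition consistency_checkers (I : Type) (C : I -> constraint)
    (descr : I -> seq bool) (f : forall i, {set lit (C i)} -> bool) : Prop :=
  polytime descr f /\ forall i, checks (f i).

(* ** CNF formulas and unit propagation *)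

(* The propositional literal (v, true) is v, and (v, false) is its negation. *)
Definition plit (V : eqType) : eqType := (V * bool)%type.
Definition neg (V : eqType) (l : plit V) : plit V := (l.1, ~~ l.2).
Definition cnf (V : eqType) : Type := seq (seq (plit V)).
Definition cnf_size (V : eqType) (F : cnf V) : nat := \sum_(c <- F) size c.

(* [up F rho l]: l is true in rho, or is made true by unit propagation on F
   started from rho.  Clauses are read as sets: repeated occurrences of a literal
   in a clause are identified. *)
Inductive up (V : eqType) (F : cnf V) (rho : V -> option bool) :
    plit V -> Prop :=
| up_init v b : rho v = Some b -> up F rho (v, b)
| up_unit c l : c \in F -> l \in c ->
    (forall l', l' \in c -> l' != l -> up F rho (neg l')) -> up F rho l.

Definition up_empty_clause (V : eqType) (F : cnf V) (rho : V -> option bool) :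
    Prop :=
  exists2 c, c \in F & forall l, l \in c -> up F rho (neg l).

(* ** CNF decompositions *)

(* rho represents D: x_{X,j} is false iff X = j is not in D, and x_{X,j} may be
   true only if j is the only remaining value of X. *)
Definition represents (C : constraint) (rho : lit C -> option bool)
    (D : {set lit C}) : Prop :=
  forall l : lit C,
    (rho l = Some false <-> l \notin D) /\
    (rho l = Some true -> [set k in D | tag k == tag l] = [set l]).

(* Inputs x, auxiliary variables y, and the output z. *)
Definition pvar (L Y : finType) : finType := (L + Y + unit)%type.
Definition Inp (L Y : finType) (l : L) : pvar L Y := inl (inl l).
Definition Out (L Y : finType) : pvar L Y := inr tt.

Definition start (L Y : finType) (rho : L -> option bool) (v : pvar L Y) :
    option bool :=
  if v is inl (inl l) then rho l else None.

Definition cnf_decomposition (r : {poly nat}) (C : constraint)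
    (f : {set lit C} -> bool) (Y : finType) (F : cnf (pvar (lit C) Y)) : Prop :=
  #|Y| <= r.[#|lit C|]%R /\
  forall (D : {set lit C}) (rho : lit C -> option bool), represents rho D ->
    [/\ forall (l : lit C) (b : bool),
          up F (start rho) (Inp Y l, b) -> rho l = Some b,
        ~ up_empty_clause F (start rho)
      & up F (start rho) (Out (lit C) Y, false) <-> f D = false].

(* ** Monotone circuits *)

(* There is one input node [inl l] for each l : L; [inr k] is the k-th gate of a
   list of gates in topological order.  Fan-in is unbounded. *)
Definition node (L : Type) : Type := (L + nat)%type.

Inductive gate (L : Type) :=
| GConst of bool
| GAnd of seq (node L)
| GOr of seq (node L).
Arguments GConst {L} b.

Definition preds (L : Type) (g : gate L) : seq (node L) :=
  match g with GConst _ => [::] | GAnd s => s | GOr s => s end.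

Definition node_before (L : Type) (k : nat) (w : node L) : bool :=
  if w is inr j then j < k else true.

Record mcircuit (L : finType) := MCircuit {
  gates : seq (gate L);
  output : node L;
  gates_acyclic : forall k, k < size gates ->
    all (node_before k) (preds (nth (GConst false) gates k));
  output_ok : node_before (size gates) output
}.

Definition circuit_size (L : finType) (c : mcircuit L) : nat :=
  #|L| + size (gates c).

Definition node_value (L : Type) (b : L -> bool) (vals : seq bool) (w : node L) :
    bool :=
  match w with inl l => b l | inr k => nth false vals k end.

Definition gate_value (L : Type) (b : L -> bool) (vals : seq bool) (g : gate L) :
    bool :=
  match g with
  | GConst x => x
  | GAnd s => all (node_value b vals) s
  | GOr s => has (node_value b vals) s
  end.

Definition circuit_value (L : finType) (c : mcircuit L) (b : L -> bool) : bool :=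
  let vals :=
    foldl (fun vals g => rcons vals (gate_value b vals g)) [::] (gates c) in
  node_value b vals (output c).

Definition computes (C : constraint) (c : mcircuit (lit C))
    (f : {set lit C} -> bool) : Prop :=
  forall D : {set lit C}, circuit_value c (fun l => l \in D) = f D.

(* Main.v *)
Require Import Defs.
From HB Require Import structures.
From mathcomp Require Import all_boot all_order all_algebra.

(** From a CNF to a circuit: unit propagation is the least fixed point of a
    monotone operator on sets of literals, reached after at most as many rounds
    as there are literals.  That a literal is not yet derived after t rounds is
    a monotone function of the domain setting, and it is obtained from the
    previous round by one layer of disjunctions (one per literal occurrence)
    and one layer of conjunctions (one per literal).

    From a circuit to a CNF: the clauses say that a gate with value 1 has
    justifying inputs with value 1 (half of the Tseitin encoding), so that unit
    propagation moves the value 0 from the inputs towards the output.  Each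
    clause has exactly one negative literal, on a gate or on the output; as no
    such variable is ever made true, nothing flows back to the inputs. *)

Set Implicit Arguments.
Unset Strict Implicit.
Unset Printing Implicit Defensive.

(** * Gate lists *)

Section GateLists.
Variable L : finType.
Implicit Types (gs : seq (gate L)) (b : L -> bool) (w : node L).

Definition gate_values b gs : seq bool :=
  foldl (fun vals g => rcons vals (gate_value b vals g)) [::] gs.

Definition acyclic gs : Prop := forall k, k < size gs ->
  all (node_before k) (preds (nth (GConst false) gs k)).

Lemma gate_values_rcons b gs g :
  gate_values b (rcons gs g) =
  rcons (gate_values b gs) (gate_value b (gate_values b gs) g).
Proof. by rewrite /gate_values -cats1 foldl_cat. Qed.

Lemma size_gate_values b gs : size (gate_values b gs) = size gs.
Proof.
elim/last_ind: gs => [|gs g IH] //.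
by rewrite gate_values_rcons !size_rcons IH.
Qed.

Lemma node_value_rcons b vals x w :
  node_before (size vals) w ->
  node_value b (rcons vals x) w = node_value b vals w.
Proof. by case: w => [l|k] //= kv; rewrite nth_rcons kv. Qed.

Lemma gate_value_rcons b vals x (g : gate L) :
  all (node_before (size vals)) (preds g) ->
  gate_value b (rcons vals x) g = gate_value b vals g.
Proof.
case: g => [//|s|s] /= /allP hs; [apply: eq_in_all | apply: eq_in_has] => w ws;
  exact: node_value_rcons (hs w ws).
Qed.

Lemma node_before_trans m n w : m <= n -> node_before m w -> node_before n w.
Proof. by case: w => //= k mn km; apply: leq_trans km mn. Qed.

Lemma acyclic_rcons gs g :
  acyclic (rcons gs g) <->
  acyclic gs /\ all (node_before (size gs)) (preds g).
Proof.
split=> [ac|[ac hg] k]; last first.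
  rewrite size_rcons ltnS nth_rcons leq_eqVlt => /orP[/eqP->|ltk].
    by rewrite ltnn eqxx.
  by rewrite ltk; apply: ac.
split=> [k ltk|].
  have := ac k; rewrite size_rcons nth_rcons ltk; apply; exact: ltnW.
by have := ac (size gs); rewrite size_rcons nth_rcons ltnn eqxx; apply.
Qed.

(** Appending gates leaves earlier values unchanged, so the final list of values satisfies the
    equations of all gates at once. *)
Lemma nth_gate_values b gs k :
  acyclic gs -> k < size gs ->
  nth false (gate_values b gs) k =
  gate_value b (gate_values b gs) (nth (GConst false) gs k).
Proof.
elim/last_ind: gs => [//|gs g IH] /acyclic_rcons [ac hg].
rewrite size_rcons ltnS gate_values_rcons !nth_rcons !size_gate_values.
rewrite leq_eqVlt => /orP[/eqP->|ltk].
  by rewrite ltnn eqxx gate_value_rcons // size_gate_values.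
rewrite ltk IH // gate_value_rcons // size_gate_values.
by apply: sub_all (ac k ltk) => w; apply: node_before_trans (ltnW ltk).
Qed.

(** Constructions refer to a node through the function of the input that it computes, so gate
    positions need not be tracked. *)
Definition has_node gs (h : (L -> bool) -> bool) : Prop :=
  exists2 w, node_before (size gs) w &
    forall b, node_value b (gate_values b gs) w = h b.

Definition extends gs n gs' : Prop :=
  [/\ acyclic gs', size gs' = size gs + n &
      forall h, has_node gs h -> has_node gs' h].

Lemma extends_refl gs : acyclic gs -> extends gs 0 gs.
Proof. by split=> //; rewrite addn0. Qed.

Lemma extends_trans gs1 gs2 gs3 m n :
  extends gs1 m gs2 -> extends gs2 n gs3 -> extends gs1 (m + n) gs3.
Proof.
case=> ac2 s2 h2 [ac3 s3 h3]; split=> //; first by rewrite s3 s2 addnA.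
by move=> h /h2 /h3.
Qed.

Lemma extends_rcons gs g :
  acyclic gs -> all (node_before (size gs)) (preds g) ->
  extends gs 1 (rcons gs g) /\
  has_node (rcons gs g) (fun b => gate_value b (gate_values b gs) g).
Proof.
move=> ac hg; split; first split.
- exact/acyclic_rcons.
- by rewrite size_rcons addn1.
- move=> h [w hw hv]; exists w.
    by rewrite size_rcons; apply: node_before_trans hw.
  by move=> b; rewrite gate_values_rcons node_value_rcons ?size_gate_values.
- exists (inr (size gs)) => [|b] /=; first by rewrite size_rcons.
  by rewrite gate_values_rcons nth_rcons size_gate_values ltnn eqxx.
Qed.

Lemma has_node_seq (A : eqType) (s : seq A) (h : A -> (L -> bool) -> bool) gs :
  (forall a, a \in s -> has_node gs (h a)) ->
  exists2 ws, all (node_before (size gs)) ws &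
    forall b, map (node_value b (gate_values b gs)) ws = map (h^~ b) s.
Proof.
elim: s => [|a s IH] hs; first by exists [::].
have [w hw vw] := hs a (mem_head _ _).
have [|ws hws vws] := IH; first by move=> c cs; apply: hs; rewrite inE cs orbT.
by exists (w :: ws) => [|b] /=; rewrite ?hw // vw vws.
Qed.

Lemma add_and (A : eqType) (s : seq A) (h : A -> (L -> bool) -> bool) gs :
  acyclic gs -> (forall a, a \in s -> has_node gs (h a)) ->
  exists2 gs', extends gs 1 gs' & has_node gs' (fun b => all (h^~ b) s).
Proof.
move=> ac /has_node_seq [ws hws vws].
have [ext [w hw vw]] := @extends_rcons gs (GAnd ws) ac hws.
exists (rcons gs (GAnd ws)) => //; exists w => // b.
by rewrite vw /= -(all_map (h^~ b) id) -vws all_map.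
Qed.

Lemma add_or (A : eqType) (s : seq A) (h : A -> (L -> bool) -> bool) gs :
  acyclic gs -> (forall a, a \in s -> has_node gs (h a)) ->
  exists2 gs', extends gs 1 gs' & has_node gs' (fun b => has (h^~ b) s).
Proof.
move=> ac /has_node_seq [ws hws vws].
have [ext [w hw vw]] := @extends_rcons gs (GOr ws) ac hws.
exists (rcons gs (GOr ws)) => //; exists w => // b.
by rewrite vw /= -(has_map (h^~ b) id) -vws has_map.
Qed.

(** The gates are appended one at a time, each to a list already grown by the others; hence the
    hypothesis ranges over all extensions of [gs]. *)
Lemma add_layer (A : eqType) (s : seq A) (h : A -> (L -> bool) -> bool) gs :
  acyclic gs ->
  (forall n gs' a, extends gs n gs' -> a \in s ->
     exists2 gs'', extends gs' 1 gs'' & has_node gs'' (h a)) ->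
  exists2 gs', extends gs (size s) gs' & forall a, a \in s -> has_node gs' (h a).
Proof.
move=> ac; elim: s => [|a s IH] hs.
  by exists gs; first exact: extends_refl.
have [|gs1 ext1 hn1] := IH.
  by move=> n gs' c e cs; apply: (hs n) => //; rewrite inE cs orbT.
have [gs2 ext2 hn2] := hs _ _ a ext1 (mem_head _ _).
exists gs2; first by rewrite /= -addn1; apply: extends_trans ext1 ext2.
move=> c; rewrite inE => /orP[/eqP-> //|/hn1].
by case: ext2 => _ _; apply.
Qed.

Lemma has_node_ext gs h1 h2 : h1 =1 h2 -> has_node gs h1 -> has_node gs h2.
Proof. by move=> e [w hw vw]; exists w => // b; rewrite vw e. Qed.

Lemma circuit_of_node gs h :
  acyclic gs -> has_node gs h ->
  exists2 c : mcircuit L, circuit_size c = #|L| + size gs &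
    forall b, circuit_value c b = h b.
Proof. by move=> ac [w hw vw]; exists (MCircuit ac hw). Qed.

(** Inputs of a gate may repeat, so the number of nodes bounds the fan-in only once duplicates are
    removed. *)
Lemma size_undup_node m (s : seq (node L)) :
  all (node_before m) s -> size (undup s) <= #|L| + m.
Proof.
move=> /allP hs.
pose t : seq (node L) := map inl (enum L) ++ map inr (iota 0 m).
have -> : #|L| + m = size t by rewrite size_cat (size_map inl) (size_map inr) size_iota cardE.
apply: uniq_leq_size (undup_uniq s) _ => w; rewrite mem_undup => /hs.
rewrite mem_cat; case: w => [l|k] /= hk; apply/orP; [left|right].
  by apply: map_f; rewrite mem_enum.
by apply: map_f; rewrite mem_iota.
Qed.

End GateLists.

(** * From CNF formulas to circuits *)

Section UnitClosure.
Variables (V : finType) (F : cnf V).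
Implicit Types (rho : V -> option bool) (S : {set (V * bool)}) (l : V * bool).

Definition up_step rho S : {set (V * bool)} :=
  [set l : V * bool | (rho l.1 == Some l.2) ||
     has (fun c => (l \in c) &&
            all (fun l' : V * bool => (l' != l) ==> (neg l' \in S)) c) F].

(** Rule induction places every derived literal in the fixed point; conversely, induction on the
    rounds shows that each iterate contains derived literals only. *)
Lemma up_stepP rho l :
  up F rho l <-> l \in iter #|{: V * bool}| (up_step rho) set0.
Proof.
have mono : {homo up_step rho : X Y / X \subset Y}.
  move=> X Y /subsetP XY; apply/subsetP=> x; rewrite !inE => /orP[-> //|].
  move=> /hasP[c cF /andP[xc /allP h]]; apply/orP; right; apply/hasP.
  exists c => //; rewrite xc; apply/allP=> l' l'c; apply/implyP=> ne.
  by apply: XY; apply: (implyP (h l' l'c)).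
split.
(* The iterate is [fixset] by definition, and [fixsetK] unfolds the fixed point once. *)
- elim=> [v b rv|c l0 cF l0c _ IH]; rewrite -[iter _ _ _]/(fixset _).
    by rewrite -(fixsetK mono) inE rv eqxx.
  rewrite -(fixsetK mono) inE; apply/orP; right; apply/hasP; exists c => //.
  by rewrite l0c; apply/allP=> l' l'c; apply/implyP=> ne; apply: IH.
- elim: #|_| l => [|t IH] l; first by rewrite inE.
  rewrite iterS inE => /orP[/eqP|/hasP[c cF /andP[lc /allP h]]].
    by case: l => v b /=; apply: up_init.
  apply: (up_unit cF lc) => l' l'c ne.
  by apply: IH; apply: (implyP (h l' l'c)).
Qed.

End UnitClosure.

(** * The rounds of unit propagation as layers of gates *)

Section CircuitOfCnf.
Variables (L Y : finType) (F : cnf (pvar L Y)).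

Local Notation V := (pvar L Y).
Local Notation lits := (enum {: V * bool}).

(* The representation in which no input is true. *)
Definition canonical_start (b : L -> bool) : V -> option bool :=
  start (fun x => if b x then None else Some false).

Definition underived t (l : V * bool) (b : L -> bool) : bool :=
  l \notin iter t (up_step F (canonical_start b)) set0.

Definition occurrences : seq (seq (V * bool) * (V * bool)) :=
  [seq (c, l) | c <- F, l <- c].

(** The clause cannot yet force this occurrence, since another of its literals is not yet
    falsified. *)
Definition open_clause t (o : seq (V * bool) * (V * bool)) (b : L -> bool) :=
  has (fun l' => underived t (neg l') b) [seq l' <- o.1 | l' != o.2].

Definition unset_at_start (l : V * bool) (b : L -> bool) : bool :=
  canonical_start b l.1 != Some l.2.

Lemma size_occurrences : size occurrences = cnf_size F.
Proof. by rewrite size_allpairs_dep /cnf_size sumnE big_map. Qed.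

(** De Morgan applied to [up_step]: the disjunction over clauses becomes a conjunction over the
    occurrences of [l], and no value of the previous round is left negated. *)
Lemma underivedS t l b :
  underived t.+1 l b =
  unset_at_start l b && all (open_clause t ^~ b) [seq o <- occurrences | o.2 == l].
Proof.
rewrite /underived iterS inE negb_or; congr (_ && _).
rewrite -all_predC; apply/allP/allP => h.
  move=> [c l1]; rewrite mem_filter /= => /andP[/eqP->].
  move=> /allpairsPdep[c' [l2 [cF lc [-> e2]]]]; subst l2.
  have := h c' cF; rewrite /= lc /= -has_predC => /hasP[l' l'c /=].
  rewrite negb_imply => /andP[ne l'S]; apply/hasP; exists l' => //.
  by rewrite mem_filter /= ne.
move=> c cF /=; case lc: (l \in c) => //=; rewrite -has_predC.
have /hasP[l' ] : open_clause t (c, l) b.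
  apply: h; rewrite mem_filter eqxx; apply/allpairsPdep.
  by exists c, l.
rewrite mem_filter /= => /andP[ne l'c] l'S; apply/hasP; exists l' => //=.
by rewrite negb_imply ne.
Qed.

(** Only the negative literal of an input depends on [b], and its condition is that input itself;
    all others give the constant true. *)
Lemma unset_at_start_node l gs :
  has_node gs (fun _ : L -> bool => true) -> has_node gs (unset_at_start l).
Proof.
case: l => [[[x|y]|[]] v] ht; try by apply: has_node_ext ht => b.
case: v; last first.
  by exists (inl x) => // b; rewrite /unset_at_start /=; case: (b x).
by apply: has_node_ext ht => b; rewrite /unset_at_start /=; case: (b x).
Qed.

Lemma underived_gates t :
  exists gs : seq (gate L),
    [/\ acyclic gs, size gs = 1 + t * (cnf_size F + #|{: V * bool}|),
        has_node gs (fun _ => true) & forall l, has_node gs (underived t l)].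
Proof.
elim: t => [|t [gs [ac sz ht hn]]].
  have ac0 : acyclic (L := L) [::] by [].
  (* The empty conjunction supplies the constant true; it is the 1 in the gate count. *)
  have [//|gs [ac sz _] ht] := add_and (s := [::] : seq nat) (h := fun _ _ => true) ac0.
  exists gs; split=> // l.
  by apply: has_node_ext ht => b; rewrite /underived inE.
have [|gs1 ext1 hn1] := @add_layer L _ occurrences (open_clause t) gs ac.
  move=> n gs' o [ac' _ k'] _; apply: add_or => // l' _.
  by apply: k'; apply: hn.
have [ac1 sz1 k1] := ext1.
have [|gs2 [ac2 sz2 k2] hn2] := @add_layer L _ lits (underived t.+1) gs1 ac1.
  move=> n gs' l [ac' _ k'] _.
  (* [None] stands for the initial condition, which thus enters the same AND gate as the occurrences
     of [l]. *)
  pose h o := if o is Some o' then open_clause t o' else unset_at_start l.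
  have [|o|gs'' ext hn''] := @add_and L _
    (None :: map Some [seq o <- occurrences | o.2 == l]) h gs'; first by [].
    rewrite inE => /orP[/eqP->|/mapP[o' + ->]] /=.
      by apply/unset_at_start_node/k'/k1.
    by rewrite mem_filter => /andP[_ /hn1]; apply: k'.
  exists gs'' => //; apply: has_node_ext hn'' => b.
  by rewrite underivedS /= all_map.
exists gs2; split=> //.
- by rewrite sz2 sz1 sz size_occurrences -cardE mulSn [in RHS](addnC (_ + _)) !addnA.
- exact/k2/k1.
- by move=> l; apply: hn2; rewrite mem_enum.
Qed.

End CircuitOfCnf.

Lemma circuit_of_decomposition (r : {poly nat}) (C : constraint)
    (f : {set lit C} -> bool) (Y : finType) (F : cnf (pvar (lit C) Y)) :
  cnf_decomposition r f F ->
  exists2 c : mcircuit (lit C), computes c f &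
    circuit_size c = #|lit C| +
      (1 + #|{: pvar (lit C) Y * bool}| *
           (cnf_size F + #|{: pvar (lit C) Y * bool}|)).
Proof.
move=> [_ dec].
have [gs [ac sz _ hn]] := underived_gates F #|{: pvar (lit C) Y * bool}|.
have [c szc vc] := circuit_of_node ac (hn (Out (lit C) Y, false)).
exists c; last by rewrite szc sz.
move=> D; rewrite vc /underived.
(* This is the representation built into [underived], so the third condition of the decomposition
   applies to it. *)
pose rho := fun x => if x \in D then None else Some false.
have rep : represents rho D.
  by move=> l; rewrite /rho; case: (l \in D).
have [_ _ hz] := dec D rho rep.
have hz' := iff_trans (iff_sym (up_stepP F (start rho) _)) hz.
case E: (f D); first by apply/negP => /hz'; rewrite E.
by apply/negbTE; rewrite negbK; apply/hz'.
Qed.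

(** * From circuits to CNF formulas *)

Section CnfOfCircuit.
Variables (L : finType) (c : mcircuit L).

Local Notation gs := (gates c).
(* The last index is not used: it only makes [inord] available. *)
Local Notation Y := ('I_(size gs).+1).
Local Notation V := (pvar L Y).

Definition gate_var k : V := inl (inr (inord k)).

Definition node_var (w : node L) : V :=
  match w with inl x => Inp Y x | inr k => gate_var k end.

(** The implication from [v] to the disjunction of [s]: a definite Horn clause once all variables
    are complemented. *)
Definition horn (v : V) (s : seq (node L)) : seq (V * bool) :=
  (v, false) :: [seq (node_var w, true) | w <- s].

Definition gate_clauses (v : V) (g : gate L) : seq (seq (V * bool)) :=
  match g with
  | GConst true => [::]
  | GConst false => [:: horn v [::]]
  | GAnd s => [seq horn v [:: w] | w <- undup s]
  | GOr s => [:: horn v (undup s)]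
  end.

Definition circuit_cnf : cnf V :=
  horn (Out L Y) [:: output c] ::
  flatten [seq gate_clauses (gate_var k) (nth (GConst false) gs k)
          | k <- iota 0 (size gs)].

(** An AND gives at most [#|L| + m] clauses of size 2, an OR one clause of size at most
    [#|L| + m + 1]; the bound covers both. *)
Lemma cnf_size_gate_clauses v g m :
  all (node_before m) (preds g) ->
  \sum_(cl <- gate_clauses v g) size cl <= 2 * (#|L| + m) + 1.
Proof.
case: g => [[]|s|s] /= hs.
- by rewrite big_nil.
- by rewrite big_seq1 addn1.
- rewrite big_map /= big_const_seq count_predT iter_addn_0 addn1 leqW //.
  by rewrite leq_mul2l size_undup_node.
- rewrite big_seq1 /= size_map addn1 ltnS mul2n -addnn.
  exact: leq_trans (size_undup_node hs) (leq_addr _ _).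
Qed.

Lemma cnf_size_circuit_cnf :
  cnf_size circuit_cnf <= 2 + circuit_size c * (2 * circuit_size c + 1).
Proof.
rewrite /cnf_size /circuit_cnf big_cons /= leq_add2l big_flatten big_map.
apply: (@leq_trans (\sum_(k <- iota 0 (size gs)) (2 * circuit_size c + 1))).
  rewrite !big_seq; apply: leq_sum => k; rewrite mem_iota add0n /= => ltk.
  apply: leq_trans (cnf_size_gate_clauses _ (gates_acyclic ltk)) _.
  by rewrite leq_add2r leq_mul2l leq_add2l ltnW.
rewrite big_const_seq count_predT size_iota iter_addn_0 mulnC leq_mul2r.
by rewrite leq_addl orbT.
Qed.

(** * Correctness of unit propagation on the clauses of a circuit *)

Variables (D : {set L}) (rho : L -> option bool).
Hypothesis rho_false : forall x, rho x = Some false <-> x \notin D.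

Let vals := gate_values (fun x => x \in D) gs.
Let value := node_value (fun x => x \in D) vals.

Definition var_value (v : V) : bool :=
  match v with
  | inl (inl x) => x \in D
  | inl (inr k) => nth false vals k
  | inr _ => value (output c)
  end.

Definition not_input (v : V) : bool := if v is inl (inl _) then false else true.

Lemma var_value_node w :
  node_before (size gs) w -> var_value (node_var w) = value w.
Proof. by case: w => //= k ltk; rewrite inordK // ltnW. Qed.

Lemma value_gate k :
  k < size gs ->
  value (inr k) = gate_value (fun x => x \in D) vals (nth (GConst false) gs k).
Proof. by move=> ltk; apply: nth_gate_values => //; exact: gates_acyclic. Qed.

(** What soundness uses of the clauses: the negative literal is never on an input, and the
    evaluation of the circuit satisfies the clause. *)
Lemma circuit_cnf_horn cl :
  cl \in circuit_cnf ->
  exists v s, [/\ cl = horn v s, not_input v &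
    (forall w, w \in s -> var_value (node_var w) = false) ->
    var_value v = false].
Proof.
rewrite inE => /orP[/eqP->|/flattenP[cls /mapP[k]]].
  exists (Out L Y), [:: output c]; split=> // h.
  by rewrite -(h _ (mem_head _ _)) var_value_node //; exact: output_ok.
rewrite mem_iota add0n /= => ltk ->.
have hp := allP (gates_acyclic ltk).
have before w : w \in preds (nth (GConst false) gs k) ->
    var_value (node_var w) = value w.
  by move=> /hp /(node_before_trans (ltnW ltk)); apply: var_value_node.
have := value_gate ltk; rewrite -(@var_value_node (inr k)) // [node_var _]/=.
case: (nth _ _ k) before => [[]|s|s] //= before vk.
- by rewrite inE => /eqP->; exists (gate_var k), [::].
- move=> /mapP[w]; rewrite mem_undup => ws ->.
  exists (gate_var k), [:: w]; split=> // h; rewrite [LHS]vk.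
  by apply/negbTE/allPn; exists w => //; rewrite -/value -before // h ?mem_head.
- rewrite inE => /eqP->; exists (gate_var k), (undup s); split=> // h.
  rewrite [LHS]vk; apply/negbTE/hasPn => w ws.
  by rewrite -/value -before // h ?mem_undup.
Qed.

(** The invariant of propagation: inputs keep their initial status, and other variables only become
    false, when their circuit value is 0. *)
Definition derivable (l : V * bool) : Prop :=
  match l with
  | (inl (inl x), b) => rho x = Some b
  | (v, b) => b = false /\ var_value v = false
  end.

Lemma derivable_not_input v b :
  not_input v -> derivable (v, b) <-> b = false /\ var_value v = false.
Proof. by case: v => [[]|]. Qed.

Lemma derivable_false v : derivable (v, false) -> var_value v = false.
Proof. by case: v => [[x /rho_false/negbTE|y []]|u []]. Qed.

Lemma up_derivable l : up circuit_cnf (start rho) l -> derivable l.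
Proof.
elim=> [[[x|y]|u] b //|cl l0 /circuit_cnf_horn [v [s [-> nv hv]]] l0c _ IH].
(* Forcing a positive literal would require [v] to be true already, which the invariant forbids. *)
move: l0c; rewrite inE => /orP[/eqP e|l0s]; last first.
  have ne : (v, false) != l0.
    by case/mapP: l0s => w _ ->; rewrite xpair_eqE andbF.
  by have /(derivable_not_input _ nv)[] := IH (v, false) (mem_head _ _) ne.
subst l0; apply/derivable_not_input => //; split=> //.
apply: hv => w ws; apply: derivable_false.
apply: (IH (node_var w, true)); last by rewrite xpair_eqE andbF.
by rewrite inE; apply/orP; right; apply/mapP; exists w.
Qed.

Lemma no_empty_clause : ~ up_empty_clause circuit_cnf (start rho).
Proof.
case=> _ /circuit_cnf_horn [v [s [-> nv _]]] h.
by have /up_derivable/(derivable_not_input _ nv)[] := h _ (mem_head _ _).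
Qed.

Lemma up_horn v s :
  horn v s \in circuit_cnf ->
  (forall w, w \in s -> up circuit_cnf (start rho) (node_var w, false)) ->
  up circuit_cnf (start rho) (v, false).
Proof.
move=> cF h; apply: (up_unit cF (mem_head _ _)) => l.
by rewrite inE => /orP[->|/mapP[w ws ->] _] //; exact: h.
Qed.

(** Completeness, by induction along the topological order: one zero input of an AND, or all inputs
    of an OR being zero, makes a clause of the gate unit. *)
Lemma up_node w :
  node_before (size gs) w -> value w = false ->
  up circuit_cnf (start rho) (node_var w, false).
Proof.
case: w => [x _ /negbT xD|k]; first by apply/up_init/rho_false.
elim/ltn_ind: k => k IH ltk.
rewrite value_gate //.
have hp := allP (gates_acyclic ltk).
have hF cl : cl \in gate_clauses (gate_var k) (nth (GConst false) gs k) ->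
    cl \in circuit_cnf.
  move=> hcl; rewrite inE; apply/orP; right; apply/flattenP; eexists; last exact: hcl.
  by apply: map_f; rewrite mem_iota.
have up_pred w : w \in preds (nth (GConst false) gs k) -> value w = false ->
    up circuit_cnf (start rho) (node_var w, false).
  move=> /hp; case: w => [x _ /negbT xD|j /= ltj]; first by apply/up_init/rho_false.
  by apply: IH => //; apply: ltn_trans ltk.
case: (nth _ _ k) hF up_pred => [[]|s|s] //= hF up_pred.
- by move=> _; apply: (@up_horn _ [::]) => //; apply: hF; rewrite inE.
- move=> /negbT/allPn[w ws /negbTE vw].
  apply: (@up_horn _ [:: w]) => [|w']; last by rewrite inE => /eqP->; exact: up_pred.
  by apply: hF; apply/mapP; exists w; rewrite ?mem_undup.
- move=> /negbT/hasPn vs; apply: (@up_horn _ (undup s)).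
    by apply: hF; rewrite inE.
  by move=> w; rewrite mem_undup => ws; apply: up_pred => //; exact/negbTE/vs.
Qed.

Lemma up_output :
  up circuit_cnf (start rho) (Out L Y, false) <->
  circuit_value c (fun x => x \in D) = false.
Proof.
split=> [/up_derivable [] //|vout].
apply: (@up_horn _ [:: output c]) => [|w]; first by rewrite inE eqxx.
by rewrite inE => /eqP->; apply: up_node => //; exact: output_ok.
Qed.

End CnfOfCircuit.

Lemma decomposition_of_circuit (r : {poly nat}) (C : constraint)
    (f : {set lit C} -> bool) (c : mcircuit (lit C)) :
  computes c f -> (size (gates c)).+1 <= r.[#|lit C|]%R ->
  cnf_decomposition r f (circuit_cnf c).
Proof.
move=> cf szr; split=> [|D rho rep]; first by rewrite card_ord.
have rho_false x : rho x = Some false <-> x \notin D by case: (rep x).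
split.
- by move=> l b /(up_derivable rho_false).
- exact: no_empty_clause rho_false.
- by rewrite -cf; exact: up_output.
Qed.

Theorem theorem2 (I : Type) (C : I -> constraint) (descr : I -> seq bool)
    (f : forall i : I, {set lit (C i)} -> bool)
    (hf : consistency_checkers descr f) :
  (exists p r : {poly nat}, forall i : I,
     exists (Y : finType) (F : cnf (pvar (lit (C i)) Y)),
       cnf_decomposition r (f i) F /\ cnf_size F <= p.[#|lit (C i)|]%R)
  <->
  (exists q : {poly nat}, forall i : I,
     exists c : mcircuit (lit (C i)),
       computes c (f i) /\ circuit_size c <= q.[#|lit (C i)|]%R).
Proof.
split=> [[p [r dec]]|[q circ]].
(* [T] bounds the number of propositional literals: two for each input, each of at most [r]
   auxiliary variables, and the output. *)
- pose T : {poly nat} := (('X + r + 1) * 2%:P)%R.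
  exists ('X + (1 + T * (p + T)))%R => i.
  have [Y [F [decF szF]]] := dec i.
  have [c cf szc] := circuit_of_decomposition decF.
  exists c; split=> //; rewrite szc.
  have hT : #|{: pvar (lit (C i)) Y * bool}| <= T.[#|lit (C i)|]%R.
    rewrite card_prod card_bool !card_sum card_unit !hornerE.
    have [szY _] := decF; apply: leq_mul => //.
    by rewrite leq_add2r leq_add2l.
  rewrite !hornerD hornerM hornerX hornerD hornerC.
  by rewrite leq_add2l leq_add2l leq_mul // leq_add.
(* The first polynomial is the bound of [cnf_size_circuit_cnf] at [q]; the second counts one
   auxiliary variable per gate and the extra index. *)
- exists (2%:P + q * (2%:P * q + 1))%R, (q + 1)%R => i.
  have [c [cf szc]] := circ i.
  exists 'I_(size (gates c)).+1, (circuit_cnf c); split.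
    apply: decomposition_of_circuit => //; rewrite hornerD hornerC -addn1 leq_add2r.
    by apply: leq_trans szc; apply: leq_addl.
  apply: leq_trans (cnf_size_circuit_cnf c) _.
  rewrite !hornerD hornerM hornerD hornerM !hornerC.
  by rewrite leq_add2l leq_mul // leq_add2r leq_mul2l.
Qed.
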